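(* Let $G$ be a torsion Abelian group. Then $G$ is perspective if and only if all its primary components are perspective.
   Context: An Abelian group $G$ is called perspective if any two isomorphic direct summands of $G$ have a common direct complement: whenever $G=A\oplus H=B\oplus K$ with $A\cong B$, there exists a subgroup $C\le G$ with $G=A\oplus C=B\oplus C$. The primary components of a torsion group $G$ are its $p$-components (the subgroups of elements of $p$-power order), for $p$ prime. *)

(* Defs.v *)
From HB Require Import structures.
From mathcomp Require Import all_boot ssralg.
From mathcomp Require Import boolp.

Set Implicit Arguments.
Unset Strict Implicit.
Unset Printing Implicit Defensive.

Import GRing.Theory.
Local Open Scope ring_scope.

(* Abelian groups are [zmodType]s and subgroups are [zmodClosed] predicates;
   with the axioms of [boolp] every Prop-valued subgroup is of this form. *)

Definition subgroup_type (G : zmodType) (A : zmodClosed G) : Type :=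
  {x : G | x \in A}.

HB.instance Definition _ (G : zmodType) (A : zmodClosed G) :=
  SubChoice.on (subgroup_type A).
HB.instance Definition _ (G : zmodType) (A : zmodClosed G) :=
  [SubChoice_isSubZmodule of subgroup_type A by <:].

Definition isomorphic (U V : zmodType) : Prop :=
  exists f : {additive U -> V}, bijective f.

Definition is_direct_sum (G : zmodType) (A B : zmodClosed G) : Prop :=
  (forall x : G, exists a b : G, [/\ a \in A, b \in B & x = a + b]) /\
  (forall x : G, x \in A -> x \in B -> x = 0).

Definition perspective (G : zmodType) : Prop :=
  forall A H B K : zmodClosed G,
    is_direct_sum A H -> is_direct_sum B K ->
    isomorphic (subgroup_type A) (subgroup_type B) ->
    exists C : zmodClosed G, is_direct_sum A C /\ is_direct_sum B C.

Definition torsion (G : zmodType) : Prop :=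
  forall x : G, exists2 n : nat, (0 < n)%N & x *+ n = 0.

Definition p_power_torsion (G : zmodType) (p : nat) : {pred G} :=
  fun x => `[< exists k : nat, x *+ (p ^ k) = 0 >].
Arguments p_power_torsion : clear implicits.

Fact p_power_torsion_zmod_closed (G : zmodType) (p : nat) :
  zmod_closed (p_power_torsion G p).
Proof.
split=> [|x y /asboolP[k xk] /asboolP[l yl]]; apply/asboolP.
  by exists 0%N; rewrite mul0rn.
exists (k + l)%N; rewrite expnD mulrnBl mulrnA xk mul0rn.
by rewrite mulnC mulrnA yl mul0rn subr0.
Qed.

HB.instance Definition _ (G : zmodType) (p : nat) :=
  GRing.isZmodClosed.Build G (p_power_torsion G p)
    (@p_power_torsion_zmod_closed G p).

Definition p_component (G : zmodType) (p : nat) : zmodType :=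
  subgroup_type (p_power_torsion G p).

(* Main.v *)
Require Import Defs.
From mathcomp Require Import all_boot ssralg.
From HB Require Import structures.
From mathcomp Require Import boolp.

(** Being perspective can be tested one prime at a time because a torsion group
    is governed by a local-global principle ([mem_locally]): an element [x]
    some positive multiple of which lies in a subgroup [S] is itself in [S] as
    soon as, for every prime [p], some multiple of [x] by an integer prime to
    [p] lies in [S].  Indeed the integers [n] with [n x] in [S] form a nonzero
    ideal, and this ideal is contained in no [pZ].

    If [G] is perspective, so is each of its direct summands: a summand [P]
    with complement [Q] turns decompositions [P = A + H = B + K] into
    [G = A + (H + Q) = B + (K + Q)], and a common complement [C] found in [G]
    gives [C] intersected with [P] by the modular law
    ([perspective_summand]).  The [p]-component is a summand, its complement
    being the subgroup of the elements of order prime to [p]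
    ([p_component_summand]).

    Conversely, the decompositions [G = A + H = B + K] and the isomorphism of
    [A] with [B] restrict to each [p]-component, which, being perspective,
    supplies a common complement [C p] there ([common_complement_at]).
    The [C p] are glued into the subgroup [glue C] of those [x] such that, for
    each prime [p], some multiple of [x] by an integer prime to [p] lies in
    [C p].  This is the direct sum of the [C p], but in this form both
    [G = A + glue C] and the triviality of the intersection of [A] with [glue C]
    are instances of the local-global principle ([glue_complement]). *)

Set Implicit Arguments.
Unset Strict Implicit.
Unset Printing Implicit Defensive.

Import GRing.Theory.
Local Open Scope ring_scope.

(** * Subgroups given by propositions *)

Definition pred_of_prop (G : zmodType) (S : G -> Prop) : {pred G} :=
  fun x => `[< S x >].

Fact pred_of_prop_zmod_closed (G : zmodType) (S : G -> Prop) :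
    S 0 -> (forall x y, S x -> S y -> S (x - y)) ->
  zmod_closed (pred_of_prop S).
Proof.
by move=> S0 SB; split=> [|x y /asboolP Sx /asboolP Sy];
  apply/asboolP; [|exact: SB].
Qed.

Definition subgroup_of (G : zmodType) (S : G -> Prop) (S0 : S 0)
    (SB : forall x y, S x -> S y -> S (x - y)) : zmodClosed G :=
  HB.pack_for (zmodClosed G) (pred_of_prop S)
    (GRing.isZmodClosed.Build G (pred_of_prop S)
      (pred_of_prop_zmod_closed S0 SB)).

Lemma subgroup_ofP (G : zmodType) (S : G -> Prop) (S0 : S 0)
    (SB : forall x y, S x -> S y -> S (x - y)) (x : G) :
  x \in subgroup_of S0 SB <-> S x.
Proof. by split=> /asboolP. Qed.

Section Zero.
Variable G : zmodType.

Fact zero_subgroupB (x y : G) : x = 0 -> y = 0 -> x - y = 0.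
Proof. by move=> -> ->; rewrite subrr. Qed.

(** The trivial subgroup turns the vanishing of an element into a membership,
    so that statements on membership give statements on orders. *)
Definition zero_subgroup : zmodClosed G :=
  subgroup_of (S := fun x : G => x = 0) erefl zero_subgroupB.

Lemma mem_zero_subgroup x : x \in zero_subgroup <-> x = 0.
Proof. exact: subgroup_ofP. Qed.

End Zero.

Section Sum.
Variables (G : zmodType) (A B : zmodClosed G).

Let in_sum (x : G) := exists a b, [/\ a \in A, b \in B & x = a + b].

Fact in_sum0 : in_sum 0.
Proof. by exists 0, 0; rewrite !rpred0 addr0. Qed.

Fact in_sumB x y : in_sum x -> in_sum y -> in_sum (x - y).
Proof.
move=> [a [b [aA bB ->]]] [a' [b' [aA' bB' ->]]].
by exists (a - a'), (b - b'); split; rewrite ?rpredB // opprD addrACA.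
Qed.

Definition subgroup_sum : zmodClosed G := subgroup_of in_sum0 in_sumB.

Lemma subgroup_sumP x :
  x \in subgroup_sum <-> exists a b, [/\ a \in A, b \in B & x = a + b].
Proof. exact: subgroup_ofP. Qed.

Lemma mem_sumr x : x \in B -> x \in subgroup_sum.
Proof.
by move=> xB; apply/subgroup_sumP; exists 0, x; rewrite add0r rpred0.
Qed.

Lemma mem_suml x : x \in A -> x \in subgroup_sum.
Proof.
by move=> xA; apply/subgroup_sumP; exists x, 0; rewrite addr0 rpred0.
Qed.

End Sum.

Section InsideSubgroup.
Variables (G : zmodType) (P : zmodClosed G).

Section Restrict.
Variable A : zmodClosed G.

Fact in_restrict0 : val (0 : subgroup_type P) \in A.
Proof. by rewrite raddf0 rpred0. Qed.

Fact in_restrictB (u v : subgroup_type P) :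
  val u \in A -> val v \in A -> val (u - v) \in A.
Proof. by move=> uA vA; rewrite raddfB rpredB. Qed.

Definition restrict : zmodClosed (subgroup_type P) :=
  subgroup_of (S := fun u : subgroup_type P => val u \in A : Prop)
    in_restrict0 in_restrictB.

Lemma restrictP (u : subgroup_type P) : u \in restrict <-> val u \in A.
Proof. exact: subgroup_ofP. Qed.

End Restrict.

Section Embed.
Variable A : zmodClosed (subgroup_type P).

Let in_embed (x : G) := exists2 u : subgroup_type P, u \in A & x = val u.

Fact in_embed0 : in_embed 0.
Proof. by exists 0; rewrite ?rpred0 ?raddf0. Qed.

Fact in_embedB x y : in_embed x -> in_embed y -> in_embed (x - y).
Proof.
by move=> [u uA ->] [v vA ->]; exists (u - v); rewrite ?rpredB ?raddfB.
Qed.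

Definition embed : zmodClosed G := subgroup_of in_embed0 in_embedB.

Lemma embedP x :
  x \in embed <-> exists2 u : subgroup_type P, u \in A & x = val u.
Proof. exact: subgroup_ofP. Qed.

End Embed.
End InsideSubgroup.

(** * Isomorphisms as correspondences *)

(** The graph of an isomorphism between subgroups, as a subgroup of the product
    of the ambient groups.  Phrased on ambient elements, an isomorphism can be
    carried to other ambient groups and restricted without coercions between
    nested subtypes. *)
Record iso_graph (G G' : zmodType) (A : zmodClosed G) (B : zmodClosed G')
    (R : G -> G' -> Prop) : Prop := IsoGraph {
  graph_dom : forall x y, R x y -> x \in A /\ y \in B;
  graph_sub : forall x y x' y', R x y -> R x' y' -> R (x - x') (y - y');
  graph_total : forall x, x \in A -> exists y, R x y;
  graph_onto : forall y, y \in B -> exists x, R x y;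
  graph_fun : forall y, R 0 y -> y = 0;
  graph_inj : forall x, R x 0 -> x = 0
}.

Lemma iso_graph_of_isomorphic (G G' : zmodType) (A : zmodClosed G)
    (B : zmodClosed G') :
  isomorphic (subgroup_type A) (subgroup_type B) -> exists R, iso_graph A B R.
Proof.
move=> [f [g fK gK]].
exists (fun x y => exists a : subgroup_type A, x = val a /\ y = val (f a)).
split.
- by move=> x y [a [-> ->]]; split; apply: valP.
- move=> x y x' y' [a [-> ->]] [a' [-> ->]].
  by exists (a - a'); rewrite !raddfB.
- by move=> x xA; exists (val (f (Sub x xA))), (Sub x xA); rewrite SubK.
- by move=> y yB; exists (val (g (Sub y yB))), (g (Sub y yB)); rewrite gK SubK.
- move=> y [a [a0 ->]]; suff -> : a = 0 by rewrite !raddf0.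
  by apply: val_inj; rewrite -a0 raddf0.
- move=> x [a [-> fa0]]; suff -> : a = 0 by rewrite raddf0.
  by apply: (can_inj fK); apply: val_inj; rewrite -fa0 !raddf0.
Qed.

Lemma isomorphic_of_iso_graph (G G' : zmodType) (A : zmodClosed G)
    (B : zmodClosed G') (R : G -> G' -> Prop) :
  iso_graph A B R -> isomorphic (subgroup_type A) (subgroup_type B).
Proof.
move=> [Rdom RB Rtot Ronto Rfun Rinj].
have Rfun2 x y y' : R x y -> R x y' -> y = y'.
  by move=> h h'; apply/subr0_eq/Rfun; rewrite -(subrr x); apply: RB.
have Rinj2 x x' y : R x y -> R x' y -> x = x'.
  by move=> h h'; apply/subr0_eq/Rinj; rewrite -(subrr y); apply: RB.
have /choice[f fR] (a : subgroup_type A) :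
    exists b : subgroup_type B, R (val a) (val b).
  have [y Ry] := Rtot _ (valP a).
  by exists (Sub y (Rdom _ _ Ry).2); rewrite SubK.
have /choice[g gR] (b : subgroup_type B) :
    exists a : subgroup_type A, R (val a) (val b).
  have [x Rx] := Ronto _ (valP b).
  by exists (Sub x (Rdom _ _ Rx).1); rewrite SubK.
have fB : zmod_morphism f.
  move=> a a'; apply: val_inj; apply: (Rfun2 _ _ _ (fR (a - a'))).
  by rewrite !raddfB; apply: RB; apply: fR.
pose fM := GRing.isZmodMorphism.Build _ _ f fB.
pose fA : {additive subgroup_type A -> subgroup_type B} := HB.pack f fM.
exists fA; exists g => [a|b]; apply: val_inj.
  exact: Rinj2 (gR _) (fR _).
exact: Rfun2 (fR _) (gR _).
Qed.

(** * Direct summands of perspective groups *)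

Lemma is_direct_sum_embed (G : zmodType) (P Q : zmodClosed G)
    (A H : zmodClosed (subgroup_type P)) :
    is_direct_sum P Q -> is_direct_sum A H ->
  is_direct_sum (embed A) (subgroup_sum (embed H) Q).
Proof.
move=> [PQ PQ0] [AH AH0]; split.
  move=> x; have [u [q [uP qQ ->]]] := PQ x.
  have [a [h [aA hH uE]]] := AH (Sub u uP).
  move: uE => /(congr1 val); rewrite SubK raddfD => uE.
  exists (val a), (val h + q); split; last by rewrite uE addrA.
    by apply/embedP; exists a.
  by apply/subgroup_sumP; exists (val h), q; split=> //; apply/embedP; exists h.
move=> x /embedP[a aA ->] /subgroup_sumP[_ [q [/embedP[h hH ->] qQ E]]].
have q0 : q = 0.
  by apply: PQ0 qQ; rewrite -(addKr (val h) q) -E addrC rpredB //; apply: valP.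
have ah : a = h by apply: val_inj; rewrite E q0 addr0.
by rewrite (AH0 a) ?raddf0 // ah.
Qed.

(** This is the modular law: the [C]-part of an element of [P] is again in [P],
    since its other part is. *)
Lemma is_direct_sum_restrict (G : zmodType) (P : zmodClosed G)
    (A : zmodClosed (subgroup_type P)) (C : zmodClosed G) :
  is_direct_sum (embed A) C -> is_direct_sum A (restrict P C).
Proof.
move=> [AC AC0]; split=> [u|u uA /restrictP uC].
  have [_ [c [/embedP[a aA ->] cC E]]] := AC (val u).
  exists a, (u - a); split=> //; last by rewrite addrC subrK.
  by apply/restrictP; rewrite raddfB /= E addrC addKr.
by apply: val_inj; rewrite raddf0; apply: AC0 => //; apply/embedP; exists u.
Qed.

Lemma isomorphic_embed (G : zmodType) (P : zmodClosed G)
    (A B : zmodClosed (subgroup_type P)) :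
    isomorphic (subgroup_type A) (subgroup_type B) ->
  isomorphic (subgroup_type (embed A)) (subgroup_type (embed B)).
Proof.
move=> /iso_graph_of_isomorphic[R [Rdom RB Rtot Ronto Rfun Rinj]].
apply: (@isomorphic_of_iso_graph _ _ _ _ (fun x y =>
  exists u v : subgroup_type P, [/\ R u v, x = val u & y = val v])).
split.
- move=> _ _ [u [v [/Rdom[uA vB] -> ->]]].
  by split; apply/embedP; [exists u | exists v].
- move=> _ _ _ _ [u [v [Ruv -> ->]]] [u' [v' [Ruv' -> ->]]].
  by exists (u - u'), (v - v'); rewrite !raddfB; split=> //; apply: RB.
- by move=> _ /embedP[u /Rtot[v Ruv] ->]; exists (val v), u, v.
- by move=> _ /embedP[v /Ronto[u Ruv] ->]; exists (val u), u, v.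
- move=> _ [u [v [Ruv u0 ->]]].
  have uE : u = 0 by apply: val_inj; rewrite -u0 raddf0.
  by rewrite (Rfun v) ?raddf0 // -uE.
- move=> _ [u [v [Ruv -> v0]]].
  have vE : v = 0 by apply: val_inj; rewrite -v0 raddf0.
  by rewrite (Rinj u) ?raddf0 // -vE.
Qed.

Lemma perspective_summand (G : zmodType) (P Q : zmodClosed G) :
  is_direct_sum P Q -> perspective G -> perspective (subgroup_type P).
Proof.
move=> PQ pG A H B K AH BK /isomorphic_embed AB.
have [C [AC BC]] := pG _ _ _ _ (is_direct_sum_embed PQ AH)
  (is_direct_sum_embed PQ BK) AB.
by exists (restrict P C); split; apply: is_direct_sum_restrict.
Qed.

(** * The local-global principle *)

Lemma mem_mulrn_gcdn (G : zmodType) (S : zmodClosed G) (x : G) (m n : nat) :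
  x *+ m \in S -> x *+ n \in S -> x *+ gcdn m n \in S.
Proof.
case: m => [|m] mS nS; first by rewrite gcd0n.
have [km kn E _] := egcdnP n (ltn0Sn m).
have -> : x *+ gcdn m.+1 n = x *+ m.+1 *+ km - x *+ n *+ kn.
  by rewrite -!mulrnA mulnC E [(n * _)%N]mulnC mulrnDr addrC addKr.
by apply: rpredB; apply: rpredMn.
Qed.

(** The least positive [n] with [n x] in [S] divides, by Bezout, every other
    such integer; so it has no prime factor. *)
Lemma mem_locally (G : zmodType) (S : zmodClosed G) (x : G) :
    (exists2 n, (0 < n)%N & x *+ n \in S) ->
    (forall p, prime p -> exists2 n, coprime p n & x *+ n \in S) ->
  x \in S.
Proof.
move=> [N N0 NS] loc.
have exn : exists n, (0 < n)%N && (x *+ n \in S) by exists N; rewrite N0.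
case: (ex_minnP exn) => n /andP[n0 nS] nmin.
case: (ltnP 1 n) => [n1|n1]; last first.
  suff n_1 : n = 1%N by rewrite n_1 in nS.
  by apply/eqP; rewrite eqn_leq n1.
have [m pm mS] := loc _ (pdiv_prime n1).
have n_gcd : n = gcdn n m.
  apply/eqP; rewrite eqn_leq; apply/andP; split.
    by apply: nmin; rewrite gcdn_gt0 n0 mem_mulrn_gcdn.
  by rewrite dvdn_leq ?dvdn_gcdl.
have : (pdiv n %| m)%N.
  by rewrite (dvdn_trans (pdiv_dvd n)) // n_gcd dvdn_gcdr.
by move: pm; rewrite prime_coprime ?pdiv_prime // => /negbTE->.
Qed.

Lemma primary_multiple (G : zmodType) (hG : torsion G) (p : nat) (x : G) :
  prime p -> exists2 n, coprime p n & x *+ n \in p_power_torsion G p.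
Proof.
move=> p_pr; have [N N0 xN] := hG x.
have [n pn E] := pfactor_coprime p_pr N0.
by exists n => //; apply/asboolP; exists (logn p N); rewrite -mulrnA -E.
Qed.

Section CoprimeTorsion.
Variables (G : zmodType) (p : nat).

Let coprime_torsion (x : G) := exists2 n, coprime p n & x *+ n = 0.

Fact coprime_torsion0 : coprime_torsion 0.
Proof. by exists 1%N; rewrite ?coprimen1 ?mul0rn. Qed.

Fact coprime_torsionB x y :
  coprime_torsion x -> coprime_torsion y -> coprime_torsion (x - y).
Proof.
move=> [m pm xm] [n pn yn]; exists (m * n)%N; first by rewrite coprimeMr pm.
by rewrite mulrnBl mulrnA xm mul0rn mulnC mulrnA yn mul0rn subr0.
Qed.

Definition coprime_torsion_subgroup : zmodClosed G :=
  subgroup_of coprime_torsion0 coprime_torsionB.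

Lemma coprime_torsion_subgroupP x :
  x \in coprime_torsion_subgroup <-> exists2 n, coprime p n & x *+ n = 0.
Proof. exact: subgroup_ofP. Qed.

End CoprimeTorsion.

Lemma p_component_summand (G : zmodType) (hG : torsion G) (p : nat) :
  prime p -> is_direct_sum (p_power_torsion G p) (coprime_torsion_subgroup G p).
Proof.
move=> p_pr; split=> [x|x /asboolP[k xk] /coprime_torsion_subgroupP[n pn xn]].
  apply/subgroup_sumP; apply: mem_locally.
    by have [N N0 xN] := hG x; exists N => //; rewrite xN rpred0.
  move=> q q_pr; have [<-|qp] := eqVneq p q.
    have [n pn xn] := primary_multiple hG x p_pr.
    by exists n => //; apply: mem_suml.
  have [n pn /asboolP[k xk]] := primary_multiple hG x p_pr.
  exists (p ^ k)%N.
    by rewrite coprimeXr // prime_coprime // dvdn_prime2 // eq_sym.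
  by apply/mem_sumr/coprime_torsion_subgroupP; exists n; rewrite // mulrnAC.
have /eqP cop : coprime (p ^ k) n by rewrite coprimeXl.
by apply/mem_zero_subgroup; rewrite -(mulr1n x) -cop mem_mulrn_gcdn //;
  apply/mem_zero_subgroup.
Qed.

(** * Gluing complements of the primary parts *)

(** Stated in the ambient group, so that the complements chosen for different
    primes all have the same type; [A] itself may be larger than [P]. *)
Definition complement_in (G : zmodType) (P A C : zmodClosed G) : Prop :=
  [/\ {subset C <= P},
      {subset P <= subgroup_sum A C} &
      forall x, x \in A -> x \in C -> x = 0].

(** Since the sum is direct, both components of an element killed by [p ^ k]
    are killed by [p ^ k]. *)
Lemma is_direct_sum_p_component (G : zmodType) (p : nat) (A H : zmodClosed G) :
    is_direct_sum A H ->
  is_direct_sum (restrict (p_power_torsion G p) A)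
    (restrict (p_power_torsion G p) H).
Proof.
move=> [AH AH0]; split=> [u|u /restrictP uA /restrictP uH]; last first.
  by apply: val_inj; rewrite raddf0; apply: AH0.
have [a [h [aA hH uE]]] := AH (val u).
have /asboolP[k uk] := valP u.
have ak : a *+ (p ^ k) = 0.
  apply: AH0; first exact: rpredMn.
  have -> : a *+ (p ^ k) = - (h *+ (p ^ k)).
    by apply/eqP; rewrite -addr_eq0 -mulrnDl -uE uk.
  by rewrite rpredN rpredMn.
have aP : a \in p_power_torsion G p by apply/asboolP; exists k.
pose v : p_component G p := Sub a aP.
exists v, (u - v); split; last by rewrite addrC subrK.
  by apply/restrictP; rewrite SubK.
by apply/restrictP; rewrite raddfB /= uE addrC addKr.
Qed.

(** An isomorphism preserves the property of being killed by [p ^ k], so its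
    graph can be cut down to the [p]-components. *)
Lemma isomorphic_p_component (G : zmodType) (p : nat) (A B : zmodClosed G) :
    isomorphic (subgroup_type A) (subgroup_type B) ->
  isomorphic (subgroup_type (restrict (p_power_torsion G p) A))
    (subgroup_type (restrict (p_power_torsion G p) B)).
Proof.
move=> /iso_graph_of_isomorphic[R [Rdom RB Rtot Ronto Rfun Rinj]].
have R0 x y : R x y -> R 0 0.
  by move=> Rxy; rewrite -{1}(subrr x) -(subrr y); apply: RB.
have RD x y x' y' : R x y -> R x' y' -> R (x + x') (y + y').
  move=> Rxy Rxy'; rewrite -[x']opprK -[y']opprK; apply/RB => //.
  by rewrite -[- x']add0r -[- y']add0r; apply/RB => //; apply: R0 Rxy.
have RM x y n : R x y -> R (x *+ n) (y *+ n).
  move=> Rxy; elim: n => [|n IHn]; first by rewrite !mulr0n; apply: R0 Rxy.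
  by rewrite !mulrS; apply: RD.
apply: (@isomorphic_of_iso_graph _ _ _ _ (fun u v => R (val u) (val v))).
split=> [u v|u v u' v'|u|v|v|u].
- by move=> /Rdom[uA vB]; split; apply/restrictP.
- by rewrite !raddfB; apply: RB.
- move=> /restrictP/Rtot[y Ruy]; have /asboolP[k uk] := valP u.
  have yP : y \in p_power_torsion G p.
    apply/asboolP; exists k; apply: Rfun.
    by rewrite -uk; apply: RM.
  by exists (Sub y yP); rewrite SubK.
- move=> /restrictP/Ronto[x Rxv]; have /asboolP[k vk] := valP v.
  have xP : x \in p_power_torsion G p.
    apply/asboolP; exists k; apply: Rinj.
    by rewrite -vk; apply: RM.
  by exists (Sub x xP); rewrite SubK.
- by rewrite raddf0 => /Rfun v0; apply: val_inj; rewrite raddf0.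
- by rewrite raddf0 => /Rinj u0; apply: val_inj; rewrite raddf0.
Qed.

Lemma complement_in_embed (G : zmodType) (P A : zmodClosed G)
    (C : zmodClosed (subgroup_type P)) :
  is_direct_sum (restrict P A) C -> complement_in P A (embed C).
Proof.
move=> [AC AC0]; split.
- by move=> _ /embedP[u _ ->]; apply: valP.
- move=> x xP; have [a [c [/restrictP aA cC E]]] := AC (Sub x xP).
  move: E => /(congr1 val); rewrite SubK raddfD => E.
  apply/subgroup_sumP; exists (val a), (val c); split=> //.
  by apply/embedP; exists c.
- move=> x xA /embedP[u uC E]; rewrite E in xA *.
  by rewrite (AC0 u) ?raddf0 //; apply/restrictP.
Qed.

Lemma common_complement_at (G : zmodType) (p : nat) (A H B K : zmodClosed G) :
    perspective (p_component G p) -> is_direct_sum A H -> is_direct_sum B K ->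
    isomorphic (subgroup_type A) (subgroup_type B) ->
  exists C : zmodClosed G, complement_in (p_power_torsion G p) A C /\
                           complement_in (p_power_torsion G p) B C.
Proof.
move=> persp AH BK AB.
have [C [AC BC]] := persp _ _ _ _ (is_direct_sum_p_component p AH)
  (is_direct_sum_p_component p BK) (isomorphic_p_component p AB).
by exists (embed C); split; apply: complement_in_embed.
Qed.

Section Glue.
Variables (G : zmodType) (C : nat -> zmodClosed G).

Let in_glue (x : G) :=
  forall p, prime p -> exists2 n, coprime p n & x *+ n \in C p.

Fact in_glue0 : in_glue 0.
Proof. by move=> p _; exists 1%N; rewrite ?coprimen1 ?mul0rn ?rpred0. Qed.

Fact in_glueB x y : in_glue x -> in_glue y -> in_glue (x - y).
Proof.
move=> xC yC p p_pr.
have [[m pm xm] [n pn yn]] := (xC p p_pr, yC p p_pr).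
exists (m * n)%N; first by rewrite coprimeMr pm.
rewrite mulrnBl mulrnA [(m * n)%N]mulnC mulrnA.
by apply: rpredB; apply: rpredMn.
Qed.

Definition glue : zmodClosed G := subgroup_of in_glue0 in_glueB.

Lemma glueP x : x \in glue <->
  forall p, prime p -> exists2 n, coprime p n & x *+ n \in C p.
Proof. exact: subgroup_ofP. Qed.

(** Away from [p], an element of [p]-power order is killed by a power of [p]. *)
Lemma sub_glue p :
  prime p -> {subset C p <= p_power_torsion G p} -> {subset C p <= glue}.
Proof.
move=> p_pr sCP x xC; apply/glueP => q q_pr.
have [->|qp] := eqVneq q p; first by exists 1%N; rewrite ?coprimen1.
have /asboolP[k xk] := sCP x xC.
exists (p ^ k)%N; last by rewrite xk rpred0.
by rewrite coprimeXr // prime_coprime // dvdn_prime2.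
Qed.

Lemma glue_complement (hG : torsion G) (A : zmodClosed G) :
    (forall p, prime p -> complement_in (p_power_torsion G p) A (C p)) ->
  is_direct_sum A glue.
Proof.
move=> AC; split=> [x|x xA /glueP xC].
  apply/subgroup_sumP; apply: mem_locally.
    by have [N N0 xN] := hG x; exists N; rewrite ?xN ?rpred0.
  move=> p p_pr; have [sCP PAC _] := AC p p_pr.
  have [n pn /PAC/subgroup_sumP[a [c [aA cC E]]]] := primary_multiple hG x p_pr.
  exists n => //; apply/subgroup_sumP; exists a, c; split=> //.
  exact: sub_glue cC.
apply/mem_zero_subgroup/mem_locally.
  by have [N N0 xN] := hG x; exists N; rewrite ?xN ?rpred0.
move=> p p_pr; have [_ _ AC0] := AC p p_pr; have [n pn xn] := xC p p_pr.
exists n => //; apply/mem_zero_subgroup.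
by apply: AC0 => //; apply: rpredMn.
Qed.

End Glue.

(** * Reduction to the primary components *)

Theorem corollary3p4 (G : zmodType) (hG : torsion G) :
  perspective G <-> (forall p : nat, prime p -> perspective (p_component G p)).
Proof.
split=> [persp p p_pr|persp A H B K AH BK AB].
  exact: perspective_summand (p_component_summand hG p_pr) persp.
have /choice[C CP] (p : nat) : exists C : zmodClosed G, prime p ->
    complement_in (p_power_torsion G p) A C /\
    complement_in (p_power_torsion G p) B C.
  (* The choice runs over all integers; [A] is a dummy value off the primes. *)
  have [p_pr|] := boolP (prime p); last by exists A.
  have [C ABC] := common_complement_at (persp p p_pr) AH BK AB.
  by exists C.
by exists (glue C); split; apply: glue_complement => // p /CP[].
Qed.
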